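(* For all $\omega\in\Omega$, $[0,1]\in\mathcal{C}_{\mathrm{C}}(\omega)$, so any sequence of outcomes $\omega$ has at least one stationary forecast that makes it computably random: $\mathcal{C}_{\mathrm{C}}(\omega)\neq\emptyset$.
   Context: $\mathbb{N}=\{1,2,\dots\}$, $\mathbb{N}_0=\mathbb{N}\cup\{0\}$. $\mathcal{C}$ is the set of all non-empty closed subintervals of $[0,1]$ (interval forecasts). For $I\in\mathcal{C}$ and $f\colon\{0,1\}\to\mathbb{R}$, $\overline{E}_I(f)=\max_{p\in I}[pf(1)+(1-p)f(0)]$. $\Omega=\{0,1\}^{\mathbb{N}}$ is the set of outcome sequences and $\Omega^\lozenge=\bigcup_{n\in\mathbb{N}_0}\{0,1\}^n$ the set of situations, with $\square$ the empty sequence. For $\omega\in\Omega$, $\omega^n$ is its initial segment of length $n$. A forecasting system is a map $\gamma\colon\Omega^\lozenge\to\mathcal{C}$. A real process is a map $F\colon\Omega^\lozenge\to\mathbb{R}$, with process difference $\Delta F(s)(x)=F(sx)-F(s)$. A supermartingale for $\gamma$ is a real process $M$ with $\overline{E}_{\gamma(s)}(\Delta M(s))\le 0$ for all $s\in\Omega^\lozenge$; a test supermartingale for $\gamma$ is a non-negative supermartingale $T$ for $\gamma$ with $T(\square)=1$. A real process $F$ is computable if there are rational numbers $r_{s,n}=(-1)^{\sigma(s,n)}a(s,n)/b(s,n)$, with $a,b,\sigma\colon\Omega^\lozenge\times\mathbb{N}_0\to\mathbb{N}_0$ computable and $b>0$, and a computable function $e\colon\Omega^\lozenge\times\mathbb{N}_0\to\mathbb{N}_0$,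 such that $n\ge e(s,N)$ implies $|r_{s,n}-F(s)|\le 2^{-N}$ for all $s,n,N$. An outcome sequence $\omega$ is computably random for $\gamma$ if $\sup_{n\in\mathbb{N}}T(\omega^n)<+\infty$ for every computable test supermartingale $T$ for $\gamma$. For $I\in\mathcal{C}$, the stationary forecasting system $\gamma_I$ is given by $\gamma_I(s)=I$ for all $s\in\Omega^\lozenge$, and $\mathcal{C}_{\mathrm{C}}(\omega)=\{I\in\mathcal{C}\colon\omega\text{ is computably random for }\gamma_I\}$. *)

(* Defs.v *)
From HB Require Import structures.
From mathcomp Require Import all_boot all_order all_algebra.
From mathcomp Require Import all_classical all_reals all_analysis.

Set Implicit Arguments.
Unset Strict Implicit.
Unset Printing Implicit Defensive.

Import Order.TTheory GRing.Theory Num.Theory.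
Local Open Scope classical_set_scope.
Local Open Scope ring_scope.

(* Codes of partial recursive functions of arity [n].  [MuPrec] recurses on the
   first argument and [MuMin] minimizes over the first argument. *)
Inductive murec : nat -> Type :=
| MuZero n : murec n
| MuSucc : murec 1
| MuProj n (i : 'I_n) : murec n
| MuComp k n (f : murec k) (g : 'I_k -> murec n) : murec n
| MuPrec n (f : murec n) (g : murec n.+2) : murec n.+1
| MuMin n (f : murec n.+1) : murec n.

(* [murec_eval c v y]: the partial function coded by [c] is defined at [v], with
   value [y].  For [MuPrec], [t] lists the successive values of the recursion. *)
Fixpoint murec_eval n (c : murec n) : n.-tuple nat -> nat -> Prop :=
  match c in murec n return n.-tuple nat -> nat -> Prop with
  | MuZero n => fun _ y => y = 0%N
  | MuSucc => fun v y => y = (thead v).+1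
  | MuProj n i => fun v y => y = tnth v i
  | MuComp k n f g => fun v y =>
      exists2 w : k.-tuple nat,
        forall i, murec_eval (g i) v (tnth w i) & murec_eval f w y
  | MuPrec n f g => fun v y =>
      exists t : nat -> nat,
        [/\ murec_eval f [tuple of behead v] (t 0%N),
            forall i, (i < thead v)%N ->
              murec_eval g [tuple of i :: t i :: behead v] (t i.+1)
          & y = t (thead v)]
  | MuMin n f => fun v y =>
      murec_eval f [tuple of y :: v] 0%N /\
      forall i, (i < y)%N -> exists z, murec_eval f [tuple of i :: v] z.+1
  end.

(* Outcomes are booleans, [true] standing for 1; the (k+1)-th outcome of a
   sequence [w] is [w k]. *)
Definition outcome_seq := nat -> bool.
Definition situation := seq bool.

Definition initial_segment (w : outcome_seq) (n : nat) : situation := mkseq w n.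

(* Bijective base-2 numeration, with the first outcome as lowest digit. *)
Definition situation_code (s : situation) : nat :=
  foldr (fun (b : bool) m => (m.*2 + b).+1) 0%N s.

Lemma situation_code_bij : bijective situation_code.
Proof.
have inj : injective situation_code.
  elim=> [|b s IH] [|c t] //= [] e.
  have ebc : b = c.
    by have := congr1 odd e; rewrite !oddD !odd_double !oddb.
  move: e; rewrite ebc => /eqP; rewrite eqn_add2r => /eqP /double_inj /IH.
  by move=> ->.
have surj m : exists s, situation_code s = m.
  elim/ltn_ind: m => -[|m] IH; first by exists [::].
  have [|s es] := IH m./2.
    by rewrite ltnS -[leqRHS]odd_double_half -addnn addnA leq_addl.
  by exists (odd m :: s); rewrite /= es addnC odd_double_half.
exists (fun m => projT1 (cid (surj m))) => [s|m].
  by apply: inj; case: cid.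
by case: cid.
Qed.

Definition computable_nat (f : situation -> nat -> nat) : Prop :=
  exists c : murec 2, forall s n,
    murec_eval c [tuple situation_code s; n] (f s n).

Section IntervalForecasts.
Variable R : realType.

(* A non-empty closed subinterval of [0,1] is determined by its endpoints. *)
Record interval_forecast := IntervalForecast {
  ifc_lo : R;
  ifc_hi : R;
  ifc_lo_ge0 : 0 <= ifc_lo;
  ifc_lo_le_hi : ifc_lo <= ifc_hi;
  ifc_hi_le1 : ifc_hi <= 1 }.

Definition ifc_set (I : interval_forecast) : set R :=
  `[ifc_lo I, ifc_hi I]%classic.

Definition unit_forecast : interval_forecast :=
  @IntervalForecast 0 1 (lexx 0) ler01 (lexx 1).

(* The supremum is a maximum: see [upper_expectation_is_max]. *)
Definition upper_expectation (I : interval_forecast) (f : bool -> R) : R :=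
  sup [set p * f true + (1 - p) * f false | p in ifc_set I].

Lemma upper_expectation_is_max (I : interval_forecast) (f : bool -> R) :
  (exists2 p, ifc_set I p &
     upper_expectation I f = p * f true + (1 - p) * f false) /\
  (forall p, ifc_set I p ->
     p * f true + (1 - p) * f false <= upper_expectation I f).
Proof.
pose g p := p * f true + (1 - p) * f false.
have gE p : g p = f false + p * (f true - f false).
  by rewrite /g mulrBl mul1r mulrBr addrCA.
have [q Iq maxq] : exists2 q, ifc_set I q & forall p, ifc_set I p -> g p <= g q.
  case: (lerP 0 (f true - f false)) => d.
  - exists (ifc_hi I) => [|p /=].
      by rewrite /ifc_set /= in_itv /= lexx ifc_lo_le_hi.
    by rewrite /ifc_set /= in_itv /= => /andP[_ ph]; rewrite !gE lerD2l ler_wpM2r.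
  - exists (ifc_lo I) => [|p /=].
      by rewrite /ifc_set /= in_itv /= lexx ifc_lo_le_hi.
    by rewrite /ifc_set /= in_itv /= => /andP[pl _]; rewrite !gE lerD2l ler_wnM2r // ltW.
have ub : ubound [set g p | p in ifc_set I] (g q) by move=> _ [p Ip <-]; exact: maxq.
have E : upper_expectation I f = g q.
  apply/eqP; rewrite eq_le; apply/andP; split.
    by apply: ge_sup => //; exists (g q), q.
  by apply: ub_le_sup; [exists (g q) | exists q].
by split; [exists q | move=> p Ip; rewrite E; exact: maxq].
Qed.

Definition forecasting_system := situation -> interval_forecast.
Definition real_process := situation -> R.

Definition process_diff (F : real_process) (s : situation) (x : bool) : R :=
  F (rcons s x) - F s.

Definition supermartingale (gamma : forecasting_system) (M : real_process) :=
  forall s, upper_expectation (gamma s) (process_diff M s) <= 0.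

Definition test_supermartingale (gamma : forecasting_system) (T : real_process) :=
  [/\ supermartingale gamma T, forall s, 0 <= T s & T [::] = 1].

Definition computable_process (F : real_process) : Prop :=
  exists (sigma a b e : situation -> nat -> nat) (r : situation -> nat -> rat),
    [/\ [/\ computable_nat sigma, computable_nat a, computable_nat b
          & computable_nat e],
        forall s n, (0 < b s n)%N,
        forall s n, r s n = (-1) ^+ sigma s n * ((a s n)%:R / (b s n)%:R)
      & forall s n N, (e s N <= n)%N -> `|ratr (r s n) - F s| <= 2 ^- N].

Definition computably_random (gamma : forecasting_system) (w : outcome_seq) :=
  forall T : real_process, computable_process T -> test_supermartingale gamma T ->
    (ereal_sup [set (T (initial_segment w n))%:E | n in [set n | (1 <= n)%N]]
      < +oo)%E.

Definition stationary (I : interval_forecast) : forecasting_system := fun=> I.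

Definition computable_forecasts (w : outcome_seq) : set interval_forecast :=
  [set I | computably_random (stationary I) w].

End IntervalForecasts.

Arguments unit_forecast {R}.

(* Main.v *)
Require Import Defs.
From HB Require Import structures.
From mathcomp Require Import all_boot all_order all_algebra.
From mathcomp Require Import all_classical all_reals all_analysis.

Import Order.TTheory GRing.Theory Num.Theory.
Local Open Scope classical_set_scope.
Local Open Scope ring_scope.

(** The interval [0,1] contains the degenerate probabilities 0 and 1, so its upper expectation
    dominates both values of a gamble ([upper_expectation_unit_ge]). A supermartingale for this
    forecast therefore cannot increase under either outcome, and a test supermartingale never
    exceeds its initial capital 1 ([supermartingale_unit_le_initial]), whatever the sequence. *)

Lemma upper_expectation_unit_ge (R : realType) (f : bool -> R) (x : bool) :
  f x <= upper_expectation unit_forecast f.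
Proof.
(* The probability [x%:R] puts all mass on the outcome [x], so the expectation under it is [f x]. *)
have [_ /(_ x%:R)] := upper_expectation_is_max unit_forecast f.
rewrite /ifc_set /= in_itv /= ler0n lern1 leq_b1 => /(_ isT).
by case: x => /=; rewrite ?subrr ?subr0 !mul1r !mul0r ?addr0 ?add0r.
Qed.

Lemma supermartingale_unit_nonincreasing (R : realType) (M : real_process R) :
  supermartingale (stationary unit_forecast) M ->
  forall s x, M (rcons s x) <= M s.
Proof.
move=> superM s x; rewrite -subr_le0.
exact: le_trans (upper_expectation_unit_ge R (process_diff M s) x) (superM s).
Qed.

Lemma supermartingale_unit_le_initial (R : realType) (M : real_process R) :
  supermartingale (stationary unit_forecast) M -> forall s, M s <= M [::].
Proof.
move=> superM; elim/last_ind => // s x; apply: le_trans.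
exact: supermartingale_unit_nonincreasing.
Qed.

Theorem proposition9 (R : realType) (omega : outcome_seq) :
  computable_forecasts omega (@unit_forecast R) /\
  (@computable_forecasts R omega) !=set0.
Proof.
suff unit_random : computable_forecasts omega (@unit_forecast R).
  by split=> //; exists unit_forecast.
(* The finite bound is the initial capital [T [::] = 1]. *)
move=> T _ [superT _ T1]; apply: (@le_lt_trans _ _ 1%E); last exact: ltry.
apply: ge_ereal_sup => _ [n _ <-].
by rewrite lee_fin -T1 supermartingale_unit_le_initial.
Qed.
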